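(* Let $G=(V,w,m)$ be a finite connected weighted graph satisfying $CD(K,\infty)$ for some $K>0$, let $D:=\operatorname{Deg}_{\max}$, let $x_0\in V$ and $f_0:=d(x_0,\cdot)$, and let $P_t=e^{t\Delta}$. The following are equivalent: (1) there is $y_0\in V$ with $d(x_0,y_0)=\frac{2D}{K}$; (2) $\operatorname{Deg}(x_0)=D$ and $\Gamma P_tf_0=e^{-2Kt}P_t\Gamma f_0$ for all $t\ge0$; (3) $\operatorname{Deg}(x_0)=D$ and $\Gamma_2 f_0=K\Gamma f_0$; (4) $\operatorname{Deg}(x_0)=D$ and $f_0=\varphi+C$ for a constant $C$ and a function $\varphi$ with $-\Delta\varphi=K\varphi$; (5) $G$ has the hypercube shell structure $HSS\left(\frac{2D}K,\frac K2,x_0\right)$.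
   Context: A weighted graph is $G=(V,w,m)$ with $V$ countable, $w:V\times V\to[0,\infty)$ symmetric with $w(x,x)=0$, $m:V\to(0,\infty)$; $x\sim y$ iff $w(x,y)>0$. Laplacian $\Delta f(x)=\frac1{m(x)}\sum_y w(x,y)(f(y)-f(x))$; $\operatorname{Deg}(x)=\frac1{m(x)}\sum_yw(x,y)$, $\operatorname{Deg}_{\max}=\max_x\operatorname{Deg}(x)$. $d$ is the combinatorial graph distance. $2\Gamma(f,g)=\Delta(fg)-f\Delta g-g\Delta f$, $2\Gamma_2(f,g)=\Delta\Gamma(f,g)-\Gamma(f,\Delta g)-\Gamma(g,\Delta f)$, $\Gamma f=\Gamma(f,f)$, $\Gamma_2f=\Gamma_2(f,f)$; $CD(K,\infty)$ means $\Gamma_2f(x)\ge K\Gamma f(x)$ for all $f$ and $x$. $d_-^{x_0}(z)=\sum_{y\sim z,\ d(y,x_0)<d(z,x_0)}\frac{w(y,z)}{m(z)}$. Hypercube shell structure $HSS(N,W,x_0)$ ($N,W>0$): (i) $\operatorname{Deg}(x)=NW$ for all $x\in V$; (ii) $G$ is bipartite; (iii) $d_-^{x_0}(x)=W\,d(x,x_0)$ for all $x\in V$.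
   Formalization: The graph is assumed to have at least two vertices: for a one-vertex graph D=0, so (1)–(4) hold, but (5) fails because the hypercube shell structure requires N=2D/K>0. *)

(* Defs.v *)
From HB Require Import structures.
From mathcomp Require Import all_boot.
From Stdlib Require Import Reals ClassicalEpsilon.
Set Implicit Arguments. Unset Strict Implicit. Unset Printing Implicit Defensive.

Open Scope R_scope.

Lemma Rplus_assoc_ssr : associative Rplus.
Proof. by move=> a b c; rewrite Rplus_assoc. Qed.
HB.instance Definition _ := Monoid.isComLaw.Build R 0%R Rplus
  Rplus_assoc_ssr Rplus_comm Rplus_0_l.

Section WG.
Variable V : finType.
Variable w : V -> V -> R.
Variable m : V -> R.

Definition weighted_graph : Prop :=
  (forall x y, w x y = w y x) /\ (forall x y, 0 <= w x y) /\
  (forall x, w x x = 0) /\ (forall x, 0 < m x).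

Definition adjb (x y : V) : bool := if Rlt_dec 0 (w x y) then true else false.

Fixpoint walkb (k : nat) (x y : V) : bool :=
  match k with
  | O => x == y
  | S k' => [exists z, walkb k' x z && adjb z y]
  end.

Definition connected : Prop := forall x y, exists k, walkb k x y.

(* combinatorial graph distance: least k with a k-step walk
   (for connected finite graphs such a k is < #|V|) *)
Definition gdist (x y : V) : nat := find (fun k => walkb k x y) (iota 0 #|V|).

Definition sumV (F : V -> R) : R := \big[Rplus/0%R]_(y : V) F y.

Definition Lap (f : V -> R) (x : V) : R :=
  / m x * sumV (fun y => w x y * (f y - f x)).

Definition Deg (x : V) : R := / m x * sumV (fun y => w x y).

Definition Degmax : R := \big[Rmax/0%R]_(x : V) Deg x.

Definition Gam (f g : V -> R) (x : V) : R :=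
  / 2 * (Lap (fun y => f y * g y) x - f x * Lap g x - g x * Lap f x).

Definition Gam2 (f g : V -> R) (x : V) : R :=
  / 2 * (Lap (Gam f g) x - Gam f (Lap g) x - Gam g (Lap f) x).

Definition CD (K : R) : Prop :=
  forall (f : V -> R) (x : V), Gam2 f f x >= K * Gam f f x.

Fixpoint iterLap (k : nat) (f : V -> R) : V -> R :=
  match k with
  | O => f
  | S k' => Lap (iterLap k' f)
  end.

(* heat semigroup P_t f = e^{t Delta} f = sum_k t^k/k! Delta^k f
   (the value of the convergent exponential series) *)
Definition Pt (t : R) (f : V -> R) (x : V) : R :=
  epsilon (inhabits 0%R)
    (fun l => infinite_sum (fun k => t ^ k / INR (Factorial.fact k) * iterLap k f x) l).

Definition dminus (x0 z : V) : R :=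
  \big[Rplus/0%R]_(y : V | adjb y z && ltn (gdist y x0) (gdist z x0)) (w y z / m z).

Definition bipartite : Prop :=
  exists c : V -> bool, forall x y, 0 < w x y -> c x <> c y.

Definition HSS (N W : R) (x0 : V) : Prop :=
  0 < N /\ 0 < W /\
  (forall x, Deg x = N * W) /\
  bipartite /\
  (forall x, dminus x0 x = W * INR (gdist x x0)).

End WG.

(* Main.v *)
Require Import Defs.
From HB Require Import structures.
From mathcomp Require Import all_boot.
From Stdlib Require Import Reals ClassicalEpsilon Lra.
From mathcomp Require Import ssralg vector Rstruct.
From Coquelicot Require Import Coquelicot.
Open Scope R_scope.

(** Call [f] admissible when [Γ f <= D / 2] everywhere.  If [h] solves the
    resolvent equation [h - Δ h = (1 + K) f] with [f] admissible, then
    [CD(K,∞)] gives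
      [(1 + K) Γ h - Δ (Γ h) / 2 <= (1 + K) Γ (f, h) <= (1 + K) (Γ f + Γ h) / 2],
    so by the maximum principle [h] is admissible; moreover [|Δ h| <= D].  For
    the supremum [M] of [f y - f x] over admissible [f] this yields
    [(1 + K) M <= M + 2 D], that is [M <= 2 D / K].  The distance to [x0] is
    admissible, and if it attains [2 D / K] then all these inequalities are
    equalities: [Γ h = D / 2] at [x0], hence everywhere by the strong maximum
    principle, hence [Γ (f - h) = 0] and [f - h] is constant, which makes [f] an
    eigenfunction up to a constant.

    For an eigenfunction [φ] with [- Δ φ = K φ], [CD(K,∞)] says that [Γ φ] is
    subharmonic, hence constant.  When [φ] is the distance to [x0] up to a
    constant, [Γ = D / 2] forces full degree and distance differences [1] along
    edges, and the eigenvalue equation becomes the shell condition. *)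

(** * Finite sums over the vertex set *)

Section Sums.
Variable V : finType.
Implicit Types F G : V -> R.

Lemma sumV_ext F G : (forall y, F y = G y) -> sumV F = sumV G.
Proof. by move=> e; apply: eq_bigr => y _; apply: e. Qed.

Lemma sumV_plus F G : sumV (fun y => F y + G y) = sumV F + sumV G.
Proof. exact: big_split. Qed.

Lemma sumV_scal c F : sumV (fun y => c * F y) = c * sumV F.
Proof.
symmetry; apply: (big_morph (fun s => c * s)); last exact: Rmult_0_r.
by move=> a b; ring.
Qed.

Lemma sumV_minus F G : sumV (fun y => F y - G y) = sumV F - sumV G.
Proof.
rewrite (sumV_ext _ (fun y => F y + -1 * G y)); last by move=> y; ring.
by rewrite sumV_plus sumV_scal; ring.
Qed.

Lemma sumV_ge0 F : (forall y, 0 <= F y) -> 0 <= sumV F.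
Proof.
move=> F0; apply: (big_ind (fun s => 0 <= s)) => //; first lra.
by move=> a b; lra.
Qed.

Lemma le_sumV F y : (forall y, 0 <= F y) -> F y <= sumV F.
Proof.
move=> F0; rewrite /sumV (bigD1 y) //=.
suff : 0 <= \big[Rplus/0]_(i | i != y) F i by lra.
apply: (big_ind (fun s => 0 <= s)) => //; first lra.
by move=> a b; lra.
Qed.

Lemma sumV_exchange (F : V -> V -> R) :
  sumV (fun x => sumV (fun y => F x y)) = sumV (fun y => sumV (fun x => F x y)).
Proof. exact: exchange_big. Qed.

End Sums.

(** * Algebra of the Laplacian and the carré du champ operator *)

Section Calculus.
Variables (V : finType) (w : V -> V -> R) (m : V -> R).
Hypothesis Hwg : weighted_graph w m.
Implicit Types f g h : V -> R.

Local Notation "'Δ'" := (Lap w m).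
Local Notation "'Γ'" := (Gam w m).
Local Notation "'Γ2'" := (Gam2 w m).
Local Notation "'D'" := (Degmax w m).
Local Notation deg := (Deg w m).

Lemma w_sym x y : w x y = w y x. Proof. by case: Hwg. Qed.
Lemma w_ge0 x y : 0 <= w x y. Proof. by case: Hwg => _ []. Qed.
Lemma m_gt0 x : 0 < m x. Proof. by case: Hwg => _ [_ []]. Qed.
Lemma Vm_gt0 x : 0 < / m x. Proof. exact: Rinv_0_lt_compat (m_gt0 x). Qed.

Lemma w_sqr_ge0 x y a : 0 <= w x y * (a * a).
Proof. exact: Rmult_le_pos (w_ge0 x y) (Rle_0_sqr a). Qed.

Lemma w_eq0 x y : ~ 0 < w x y -> w x y = 0.
Proof. by have := w_ge0 x y; lra. Qed.

Lemma adjbP x y : reflect (0 < w x y) (adjb w x y).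
Proof. by rewrite /adjb; case: Rlt_dec => ?; constructor. Qed.

Lemma adjb_sym x y : adjb w x y = adjb w y x.
Proof. by rewrite /adjb w_sym. Qed.

Lemma Lap_ext f g x : (forall y, f y = g y) -> Δ f x = Δ g x.
Proof. by move=> e; rewrite /Lap; congr (_ * _); apply: sumV_ext => y; rewrite !e. Qed.

Lemma Lap_lin a b f g x :
  Δ (fun y => a * f y + b * g y) x = a * Δ f x + b * Δ g x.
Proof.
rewrite /Lap.
have -> : sumV (fun y => w x y * (a * f y + b * g y - (a * f x + b * g x))) =
  a * sumV (fun y => w x y * (f y - f x)) + b * sumV (fun y => w x y * (g y - g x)).
  by rewrite -!sumV_scal -sumV_plus; apply: sumV_ext => y; ring.
by ring.
Qed.

Lemma Lap_add_const f g c x : (forall y, f y = g y + c) -> Δ f x = Δ g x.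
Proof.
by move=> e; rewrite /Lap; congr (_ * _); apply: sumV_ext => y; rewrite !e; ring.
Qed.

Lemma GamE f g x :
  Γ f g x = / 2 * (/ m x * sumV (fun y => w x y * ((f y - f x) * (g y - g x)))).
Proof.
rewrite /Gam /Lap.
have -> : sumV (fun y => w x y * ((f y - f x) * (g y - g x))) =
   sumV (fun y => w x y * (f y * g y - f x * g x))
   - f x * sumV (fun y => w x y * (g y - g x))
   - g x * sumV (fun y => w x y * (f y - f x)).
  by rewrite -!sumV_scal -!sumV_minus; apply: sumV_ext => y; ring.
by ring.
Qed.

Lemma Gam_sym f g x : Γ f g x = Γ g f x.
Proof. by rewrite !GamE; do 2!congr (_ * _); apply: sumV_ext => y; ring. Qed.

Lemma Gam_linl a b f g h x :
  Γ (fun y => a * f y + b * g y) h x = a * Γ f h x + b * Γ g h x.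
Proof.
rewrite !GamE.
have -> : sumV (fun y => w x y *
    ((a * f y + b * g y - (a * f x + b * g x)) * (h y - h x))) =
  a * sumV (fun y => w x y * ((f y - f x) * (h y - h x)))
  + b * sumV (fun y => w x y * ((g y - g x) * (h y - h x))).
  by rewrite -!sumV_scal -sumV_plus; apply: sumV_ext => y; ring.
by ring.
Qed.

Lemma Gam_ext_const f1 f2 g1 g2 c d x :
  (forall y, f1 y = f2 y + c) -> (forall y, g1 y = g2 y + d) ->
  Γ f1 g1 x = Γ f2 g2 x.
Proof.
move=> ef eg; rewrite !GamE; do 2!congr (_ * _).
by apply: sumV_ext => y; rewrite !ef !eg; ring.
Qed.

Lemma Gam_ge0 f x : 0 <= Γ f f x.
Proof.
rewrite GamE; have := Vm_gt0 x.
suff : 0 <= sumV (fun y => w x y * ((f y - f x) * (f y - f x))) by move=> *; nra.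
by apply: sumV_ge0 => y; apply: w_sqr_ge0.
Qed.

Lemma Gam_sub f g x :
  Γ (fun y => f y - g y) (fun y => f y - g y) x = Γ f f x - 2 * Γ f g x + Γ g g x.
Proof.
rewrite (Gam_ext_const _ (fun y => 1 * f y + -1 * g y)
                       _ (fun y => 1 * f y + -1 * g y) 0 0); try by move=> y; ring.
rewrite Gam_linl (Gam_sym f) (Gam_sym g) !Gam_linl (Gam_sym g f); ring.
Qed.

Lemma Gam2E f x : Γ2 f f x = / 2 * Δ (Γ f f) x - Γ f (Δ f) x.
Proof. by rewrite /Gam2; field. Qed.

(** The factor [m x] cancels the normalisation of the Laplacian. What remains is a double sum
    invariant under exchanging the vertices, since [w] is symmetric, minus a diagonal part symmetric
    in the two functions. *)
Lemma Lap_self_adjoint f g :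
  sumV (fun x => m x * (f x * Δ g x)) = sumV (fun x => m x * (g x * Δ f x)).
Proof.
have E u v : sumV (fun x => m x * (u x * Δ v x)) =
    sumV (fun x => sumV (fun y => w x y * (u x * v y)))
    - sumV (fun x => sumV (fun y => w x y * (u x * v x))).
  rewrite -sumV_minus; apply: sumV_ext => x.
  rewrite -sumV_minus /Lap.
  have -> : sumV (fun y => w x y * (u x * v y) - w x y * (u x * v x))
      = u x * sumV (fun y => w x y * (v y - v x)).
    by rewrite -sumV_scal; apply: sumV_ext => y; ring.
  by field; have := m_gt0 x; lra.
rewrite !E; congr (_ - _).
  by rewrite sumV_exchange; do 2!apply: sumV_ext => ?; rewrite w_sym; ring.
by do 2!apply: sumV_ext => ?; ring.
Qed.

(** Self-adjointness tested against the constant 1, which the Laplacian kills. *)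
Lemma sum_m_Lap f : sumV (fun x => m x * Δ f x) = 0.
Proof.
rewrite (sumV_ext _ _ (fun x => m x * (1 * Δ f x))); last by move=> x; ring.
rewrite (Lap_self_adjoint (fun=> 1)).
rewrite (sumV_ext _ _ (fun x => 0 * m x)); first by rewrite sumV_scal; ring.
move=> x; suff -> : Δ (fun=> 1) x = 0 by ring.
rewrite /Lap (sumV_ext _ _ (fun y => 0 * w x y)); first by rewrite sumV_scal; ring.
by move=> y; ring.
Qed.

Lemma Deg_ge0 x : 0 <= deg x.
Proof.
rewrite /Deg; have := Vm_gt0 x.
have : 0 <= sumV (fun y => w x y) by apply: sumV_ge0 => y; apply: w_ge0.
by nra.
Qed.

Lemma Deg_le_max x : deg x <= D.
Proof.
rewrite /Degmax; have := mem_index_enum x.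
elim: (index_enum V) => [|y s IH]; rewrite ?in_nil // in_cons big_cons.
by case/orP=> [/eqP <-|/IH h]; [apply: Rmax_l | apply: Rle_trans h (Rmax_r _ _)].
Qed.

Lemma Degmax_ge0 : V -> 0 <= D.
Proof. by move=> x; apply: Rle_trans (Deg_ge0 x) (Deg_le_max x). Qed.

(* Expand [0 <= sum_y w x y (f y - f x - s)^2 / m x]. *)
Lemma Lap_young f s x : 2 * s * Δ f x <= 2 * Γ f f x + s * s * deg x.
Proof.
rewrite GamE /Lap /Deg.
have : 0 <= sumV (fun y => w x y * ((f y - f x - s) * (f y - f x - s))).
  by apply: sumV_ge0 => y; apply: w_sqr_ge0.
have -> : sumV (fun y => w x y * ((f y - f x - s) * (f y - f x - s))) =
   sumV (fun y => w x y * ((f y - f x) * (f y - f x)))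
   - 2 * s * sumV (fun y => w x y * (f y - f x)) + s * s * sumV (fun y => w x y).
  by rewrite -!sumV_scal -sumV_minus -sumV_plus; apply: sumV_ext => y; ring.
have := Vm_gt0 x; nra.
Qed.

(** A single term of a sum of nonnegative terms: this is how bounds on [Γ] control increments along
    edges. *)
Lemma edge_le_Gam f x y : w x y * / m x * ((f y - f x) * (f y - f x)) <= 2 * Γ f f x.
Proof.
rewrite GamE.
have := le_sumV _ (fun y => w x y * ((f y - f x) * (f y - f x))) y.
have h z := w_sqr_ge0 x z (f z - f x).
by move/(_ h); have := Vm_gt0 x; nra.
Qed.

(** * Maximum principles and the resolvent equation *)

Lemma Lap_max_neighbour u M x y :
  (forall z, u z <= M) -> u x = M -> 0 <= Δ u x -> adjb w x y -> u y = M.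
Proof.
move=> uM ux L0 /adjbP wxy.
(* At a maximum these terms are all nonnegative and sum to [- m x * Δ u x <= 0], so each vanishes; a
   positive weight then forces equality of values. *)
have h z : 0 <= w x z * (u x - u z) by have := w_ge0 x z; have := uM z; nra.
have := le_sumV _ _ y h.
have E : sumV (fun z => w x z * (u x - u z)) = - (m x * Δ u x).
  rewrite /Lap -Rmult_assoc Rinv_r; last by have := m_gt0 x; lra.
  rewrite Rmult_1_l -[RHS]Rmult_1_l Ropp_mult_distr_r_reverse Ropp_mult_distr_l.
  by rewrite -sumV_scal; apply: sumV_ext => z; ring.
by rewrite E => h1; have := m_gt0 x; have := uM y; have := h y; nra.
Qed.

Lemma exists_argmax u : V -> exists x, forall y : V, u y <= u x.
Proof.
move=> x0.
have [x hx] : exists x, forall y, y \in enum V -> u y <= u x.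
  elim: (enum V) => [|a s [x hx]]; first by exists x0.
  case: (Rle_lt_dec (u a) (u x)) => h.
    by exists x => y; rewrite in_cons => /orP[/eqP -> //|/hx].
  by exists a => y; rewrite in_cons => /orP[/eqP ->|/hx]; lra.
by exists x => y; apply: hx; rewrite mem_enum.
Qed.

Lemma Lap_at_max u x : (forall y, u y <= u x) -> Δ u x <= 0.
Proof.
move=> h; rewrite /Lap.
have : 0 <= sumV (fun y => -1 * (w x y * (u y - u x))).
  by apply: sumV_ge0 => y; have := w_ge0 x y; have := h y; nra.
by rewrite sumV_scal; have := Vm_gt0 x; nra.
Qed.

Lemma resolvent_le0 u : (forall x, u x = Δ u x) -> forall x, u x <= 0.
Proof.
move=> e x; have [z hz] := exists_argmax u x.
by apply: Rle_trans (hz x) _; rewrite e; apply: Lap_at_max.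
Qed.

Lemma resolvent_inj u v :
  (forall x, u x - Δ u x = v x - Δ v x) -> forall x, u x = v x.
Proof.
move=> e x.
have E a y : a * u y + - a * v y = Δ (fun z => a * u z + - a * v z) y.
  by rewrite Lap_lin (_ : Δ u y = u y - v y + Δ v y); [ring | have := e y; lra].
have := resolvent_le0 _ (E 1) x; have := resolvent_le0 _ (E (-1)) x.
by move=> /= h1 h2; lra.
Qed.

(** An injective endomorphism of a finite-dimensional space is onto; injectivity comes from the
    maximum principle. *)
Lemma resolvent_surj f : exists h, forall x, h x - Δ h x = f x.
Proof.
(* [R^o] is the real line as a module over itself, which makes the finite functions a vector
   space. *)
pose T (u : {ffun V -> R^o}) : {ffun V -> R^o} := [ffun x => u x - Δ u x].
have Tlin : linear T.
  move=> a u v; apply/ffunP => x; rewrite !ffunE.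
  rewrite (Lap_ext _ (fun y => a * u y + 1 * v y)).
    rewrite Lap_lin.
    by change (a * u x + v x - (a * Δ u x + 1 * Δ v x)
               = a * (u x - Δ u x) + (v x - Δ v x)); ring.
  by move=> y; rewrite !ffunE; change (a * u y + v y = a * u y + 1 * v y); ring.
pose TL := GRing.isLinear.Build R {ffun V -> R^o} {ffun V -> R^o} _ T Tlin.
pose L : {linear {ffun V -> R^o} -> {ffun V -> R^o}} := HB.pack T TL.
have inj : lker (linfun L) == 0%VS.
  apply/lker0P => u v; rewrite !lfunE /= => /ffunP e.
  apply/ffunP => x; apply: (resolvent_inj u v) => y.
  by have := e y; rewrite !ffunE.
exists ((linfun L)^-1%VF [ffun x => f x]) => x.
have /ffunP/(_ x) := lker0_lfunVK inj [ffun x => f x].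
by rewrite lfunE /= !ffunE.
Qed.

(** * Graph distance *)

Lemma walkb_consl k x z y : adjb w x z -> walkb w k z y -> walkb w k.+1 x y.
Proof.
move=> xz; elim: k y => [|k IH] y.
  by move/eqP <-; apply/existsP; exists x; rewrite /= eqxx.
by case/existsP=> u /andP[/IH zu uy]; apply/existsP; exists u; apply/andP.
Qed.

Lemma walkb_sym k x y : walkb w k x y -> walkb w k y x.
Proof.
elim: k y => [|k IH] y /=; first by rewrite eq_sym.
case/existsP=> u /andP[/IH ux uy]; apply: walkb_consl ux.
by rewrite adjb_sym.
Qed.

Lemma walkb_connect k x y : walkb w k x y -> connect (adjb w) x y.
Proof.
elim: k y => [|k IH] y; first by move/eqP <-; apply: connect0.
by case/existsP=> u /andP[/IH xu uy]; apply: connect_trans xu (connect1 uy).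
Qed.

Lemma path_walkb x p : path (adjb w) x p -> walkb w (size p) x (last x p).
Proof.
elim: p x => [|z p IH] x /=; first by rewrite eqxx.
by case/andP=> xz /IH; apply: walkb_consl.
Qed.

Lemma gdist_sym x y : gdist w x y = gdist w y x.
Proof. by apply: eq_find => k; apply/idP/idP; apply: walkb_sym. Qed.

Lemma gdist_min k x y : walkb w k x y -> (gdist w x y <= k)%nat.
Proof.
move=> xy; rewrite leqNgt; apply/negP => lt.
have kn : (k < #|V|)%nat.
  apply: leq_trans lt _.
  by have := find_size (fun j => walkb w j x y) (seq.iota 0 #|V|); rewrite size_iota.
by have := before_find 0%nat lt; rewrite nth_iota // add0n xy.
Qed.

Lemma gdist0 x : gdist w x x = 0%nat.
Proof. by apply/eqP; rewrite -leqn0; apply: gdist_min; rewrite /= eqxx. Qed.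

Hypothesis Hconn : connected w.

(** Removing repetitions from a path brings its length below [#|V|], so the bounded search defining
    [gdist] succeeds. *)
Lemma gdist_walk x y : walkb w (gdist w x y) x y.
Proof.
have has_k : has (fun k => walkb w k x y) (seq.iota 0 #|V|).
  have [k /walkb_connect/connectP[p0 xp0 ->]] := Hconn x y.
  case: (shortenP xp0) => p xp up _.
  apply/hasP; exists (size p); last exact: path_walkb.
  by rewrite mem_iota /= add0n; have := max_card (mem (x :: p)); rewrite (card_uniqP up).
have := nth_find 0%nat has_k; rewrite nth_iota //.
by move: has_k; rewrite has_find size_iota.
Qed.

Lemma gdist_adj x y z : adjb w y z -> (gdist w x z <= (gdist w x y).+1)%nat.
Proof.
move=> yz; apply: gdist_min; apply/existsP; exists y; apply/andP; split=> //.
exact: gdist_walk.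
Qed.

Lemma connected_ind (P : V -> Prop) x :
  P x -> (forall y z, P y -> adjb w y z -> P z) -> forall y, P y.
Proof.
move=> Px step y; have [k] := Hconn x y.
elim: k y => [|k IH] y; first by move/eqP <-.
by case/existsP=> u /andP[/IH Pu uy]; apply: step Pu uy.
Qed.

(** Strong maximum principle: the maximal value passes from each vertex to its neighbours, hence to
    the whole connected graph. *)
Lemma const_of_subharmonic u x :
  (forall y, u y <= u x) -> (forall y, 0 <= Δ u y) -> forall y, u y = u x.
Proof.
move=> max sub; apply: (connected_ind _ x) => // y z uy yz.
exact: (Lap_max_neighbour u _ y).
Qed.

Lemma subharmonic_eq u x y : (forall z, 0 <= Δ u z) -> u y = u x.
Proof.
move=> sub; have [z hz] := exists_argmax u x.
by rewrite (const_of_subharmonic u z) // (const_of_subharmonic u z _ _ x).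
Qed.

(** * Gradient of the distance to a root *)

Section Distance.
Variable x0 : V.
Let r x := INR (gdist w x0 x).

Lemma dist_adj x y : adjb w x y -> r y <= r x + 1.
Proof. by move/(gdist_adj x0)/leP/le_INR; rewrite S_INR. Qed.

Lemma dist_adj_abs x y : adjb w x y -> -1 <= r y - r x <= 1.
Proof.
by move=> xy; have := dist_adj _ _ xy; rewrite adjb_sym in xy; have := dist_adj _ _ xy; lra.
Qed.

Lemma w_dist_le x y : w x y * ((r y - r x) * (r y - r x)) <= w x y.
Proof.
have w0 := w_ge0 x y.
case: (adjbP x y) => [/adjbP/dist_adj_abs h|/w_eq0 ->]; last lra.
have h2 : 0 <= 1 - (r y - r x) * (r y - r x) by nra.
by have := Rmult_le_pos _ _ w0 h2; lra.
Qed.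

(** The deficit is a sum of terms that are nonnegative because distances change by at most 1 along
    edges. It serves both the upper bound on [Γ r] and the analysis of equality. *)
Lemma two_Gam_dist x :
  deg x - 2 * Γ r r x = / m x * sumV (fun y => w x y - w x y * ((r y - r x) * (r y - r x))).
Proof. by rewrite GamE (sumV_minus _ (fun y => w x y)) /Deg; field; have := m_gt0 x; lra. Qed.

Lemma Gam_dist_le_Deg x : 2 * Γ r r x <= deg x.
Proof.
have := two_Gam_dist x; have := Vm_gt0 x.
suff : 0 <= sumV (fun y => w x y - w x y * ((r y - r x) * (r y - r x))) by nra.
by apply: sumV_ge0 => y; have := w_dist_le x y; lra.
Qed.

Lemma Gam_dist_le x : Γ r r x <= D / 2.
Proof. by have := Gam_dist_le_Deg x; have := Deg_le_max x; lra. Qed.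

Lemma dist_root : r x0 = 0. Proof. by rewrite /r gdist0. Qed.

(** Every neighbour of the root is at distance exactly 1, so the deficit vanishes there. *)
Lemma Gam_dist_root : 2 * Γ r r x0 = deg x0.
Proof.
suff : deg x0 - 2 * Γ r r x0 = 0 by lra.
rewrite two_Gam_dist (sumV_ext _ _ (fun y => 0 * w x0 y)).
  by rewrite sumV_scal; ring.
move=> y; case: (adjbP x0 y) => [wxy|]; last by move/w_eq0 ->; ring.
have [yx|yx] := eqVneq y x0; first by case: Hwg wxy => _ [_ []]; rewrite yx => ->; lra.
have h1 : r y = 1.
  have : (0 < gdist w x0 y)%nat.
    rewrite lt0n; apply: contra yx => /eqP d0.
    by have := gdist_walk x0 y; rewrite d0 eq_sym.
  move/leP/le_INR; have /dist_adj := introT (adjbP x0 y) wxy.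
  by rewrite dist_root /r /=; lra.
by rewrite h1 dist_root; ring.
Qed.

End Distance.

(** * The sharp diameter bound *)

Variables (K : R) (HK : 0 < K) (HCD : CD w m K).

Definition admissible f := forall x, Γ f f x <= D / 2.

(** Makes the supremum in the diameter bound finite: admissibility bounds the increment along each
    edge uniformly in [f], and a walk joins any two vertices. *)
Lemma admissible_bounded x y :
  exists B, forall f, admissible f -> f y - f x <= B.
Proof.
move: y; apply: (connected_ind _ x); first by exists 0 => f _; lra.
(* The increment t over the new edge satisfies [t * t <= D * m y / w y z], and [t <= 1 + t * t]. *)
move=> y z [B HB] /adjbP wyz; exists (B + 1 + D * m y / w y z) => f af.
have h := edge_le_Gam f y z; have h2 := af y; have h3 := HB f af.
have my := m_gt0 y.
have : (f z - f y) * (f z - f y) <= D * m y / w y z.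
  have E : (f z - f y) * (f z - f y) =
     w y z * / m y * ((f z - f y) * (f z - f y)) * (m y / w y z) by field; lra.
  rewrite E (_ : D * m y / w y z = D * (m y / w y z)); last by field; lra.
  apply: Rmult_le_compat_r; last lra.
  by apply: Rlt_le; apply: Rdiv_lt_0_compat.
have := Rle_0_sqr (f z - f y - 1); have := Rle_0_sqr (f z - f y).
by rewrite /Rsqr; lra.
Qed.

(** Applying [Γ] against [h] to the resolvent equation gives [(1 + K) * Γ f h = Γ h h - Γ h (Δ h)];
    the curvature condition bounds the last term. *)
Lemma resolvent_Gam f h : (forall x, h x - Δ h x = (1 + K) * f x) ->
  forall x, (1 + K) * Γ h h x - / 2 * Δ (Γ h h) x <= (1 + K) * Γ f h x.
Proof.
move=> eh x.
have -> : (1 + K) * Γ f h x = Γ h h x - Γ h (Δ h) x.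
  rewrite (Gam_sym h (Δ h)).
  have -> : (1 + K) * Γ f h x = Γ (fun y => (1 + K) * f y + 0 * f y) h x.
    by rewrite Gam_linl; ring.
  rewrite (Gam_ext_const _ (fun y => 1 * h y + -1 * Δ h y) h h 0 0).
  - by rewrite Gam_linl; ring.
  - by move=> y; rewrite Rmult_0_l Rplus_0_r -eh; ring.
  by move=> y; ring.
by have := HCD h x; rewrite Gam2E; lra.
Qed.

Lemma Gam_young f h x : 2 * Γ f h x <= Γ f f x + Γ h h x.
Proof. by have := Gam_ge0 (fun y => f y - h y) x; rewrite Gam_sub; lra. Qed.

Lemma resolvent_admissible f h : (forall x, h x - Δ h x = (1 + K) * f x) ->
  admissible f -> admissible h.
Proof.
move=> eh af x; have [z hz] := exists_argmax (Γ h h) x.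
apply: Rle_trans (hz x) _.
have := resolvent_Gam f h eh z; have := Lap_at_max _ _ hz.
have := Gam_young f h z; have := af z; nra.
Qed.

Lemma Lap_admissible f x : admissible f -> - D <= Δ f x <= D.
Proof.
move=> af; have := af x; have := Deg_le_max x.
by have := Lap_young f 1 x; have := Lap_young f (-1) x; lra.
Qed.

Lemma admissible_diam f x y : admissible f -> f y - f x <= 2 * D / K.
Proof.
pose S s := exists f, admissible f /\ s = f y - f x.
have [M [ubM lubM]] : {M | is_lub S M}.
  apply: completeness.
    by have [B HB] := admissible_bounded x y; exists B => s [g [ag ->]]; apply: HB.
  (* The zero function shows that the set of increments is inhabited. *)
  exists (0 - 0), (fun=> 0); split=> // z; rewrite GamE.
  rewrite (sumV_ext _ _ (fun=> 0 * 0)); last by move=> ?; ring.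
  by rewrite sumV_scal; have := Degmax_ge0 x; lra.
(* The resolvent of [g] is again admissible, so its increment is at most [M], and its Laplacian
   costs at most [D] at each endpoint. *)
have step g : admissible g -> (1 + K) * (g y - g x) <= M + 2 * D.
  move=> ag; have [h eh] := resolvent_surj (fun z => (1 + K) * g z).
  have ah := resolvent_admissible _ _ eh ag.
  have : h y - h x <= M by apply: ubM; exists h.
  have := Lap_admissible h x ah; have := Lap_admissible h y ah.
  by have := eh x; have := eh y; lra.
have HM : M <= (M + 2 * D) / (1 + K).
  apply: lubM => s [g [/step hg ->]].
  by apply/Rle_div_r; lra.
have {}HM : M <= 2 * D / K.
  by apply/Rle_div_r => //; move/Rle_div_r: HM; lra.
by move=> af; apply: Rle_trans HM; apply: ubM; exists f.
Qed.

Lemma diam_eigen f x y : admissible f -> f y - f x = 2 * D / K ->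
  deg x = D /\ exists C, forall z, - Δ (fun t => f t - C) z = K * (f z - C).
Proof.
move=> af efyx; have [h eh] := resolvent_surj (fun z => (1 + K) * f z).
have ah := resolvent_admissible _ _ eh af.
have hd := admissible_diam h x y ah.
have [hx hy] := (Lap_admissible h x ah, Lap_admissible h y ah).
have E : (1 + K) * (f y - f x) = 2 * D / K + 2 * D by rewrite efyx; field; lra.
(* The increment of [h] is at most [2 * D / K] and its Laplacian at most [D] in absolute value, so
   [E] leaves no slack in any of these bounds. *)
have Lx : Δ h x = D by have := eh x; have := eh y; lra.
(* Now [2 * D <= 2 * Γ h h x + deg x <= D + D], so both summands equal [D]. *)
have y1 := Lap_young h 1 x; have dx := Deg_le_max x; have ahx := ah x.
split; first lra.
have Gh : forall z, Γ h h z = D / 2.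
  apply: (connected_ind _ x); first lra.
  move=> a b Ga; apply: (Lap_max_neighbour (Γ h h)) => //.
  have := resolvent_Gam f h eh a; have := Gam_young f h a; have := af a.
  by rewrite Ga; nra.
have G0 z : Γ (fun t => f t - h t) (fun t => f t - h t) z = 0.
  apply: Rle_antisym; last exact: Gam_ge0.
  have LG : Δ (Γ h h) z = 0.
    rewrite (Lap_ext _ (fun=> D / 2)) // /Lap.
    by rewrite (sumV_ext _ _ (fun=> 0 * 0)) ?sumV_scal; [ring | move=> ?; ring].
  have := resolvent_Gam f h eh z; rewrite LG Gh Gam_sub Gh => ?.
  have := af z; nra.
have fh : forall z, f z - h z = f x - h x.
  apply: (connected_ind _ x) => // a b <- /adjbP ab.
  have := edge_le_Gam (fun t => f t - h t) a b; rewrite G0.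
  have p0 := Rmult_lt_0_compat _ _ ab (Vm_gt0 a) => le0.
  have d0 := Rle_0_sqr (f b - h b - (f a - h a)).
  have : Rsqr (f b - h b - (f a - h a)) = 0 by apply: Rle_antisym => //; rewrite /Rsqr; nra.
  by move/Rsqr_0_uniq; lra.
(* With [c] the constant value of [f - h], the resolvent equation reads
   [- Δ h = K * f + c = K * (f + c / K)]. *)
exists (- (f x - h x) / K) => z.
rewrite (Lap_add_const _ h ((f x - h x) - (- (f x - h x) / K))).
  have := eh z; have := fh z => e1 e2.
  have -> : K * (f z - - (f x - h x) / K) = K * f z + (f x - h x) by field; lra.
  lra.
by move=> t; have := fh t; lra.
Qed.

(** * Eigenfunctions and equality in the curvature condition *)

Definition eigen f := forall x, - Δ f x = K * f x.

Lemma eigen_Gam_const phi : eigen phi -> forall x y, Γ phi phi x = Γ phi phi y.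
Proof.
move=> ephi x y; apply: subharmonic_eq => z.
have := HCD phi z; rewrite Gam2E.
have -> : Γ phi (Δ phi) z = - K * Γ phi phi z.
  rewrite Gam_sym (Gam_ext_const _ (fun t => - K * phi t + 0 * phi t) _ phi 0 0).
  - by rewrite Gam_linl; ring.
  - by move=> t; have := ephi t; lra.
  by move=> t; ring.
by lra.
Qed.

(** The operator whose quadratic form, weighted by [m], is the integrated defect in the curvature
    condition. *)
Let L f x := Δ (Δ f) x + K * Δ f x.

(** Summation against [m] kills the term [Δ (Γ f f)], and integration by parts turns each remaining
    [Γ f g] into [- f * Δ g]. *)
Lemma sum_m_CD_defect f :
  sumV (fun x => m x * (Γ2 f f x - K * Γ f f x)) = sumV (fun x => m x * (f x * L f x)).
Proof.
have sumG g : sumV (fun x => m x * Γ f g x) = - sumV (fun x => m x * (f x * Δ g x)).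
  rewrite (sumV_ext _ _ (fun x => / 2 * (m x * Δ (fun y => f y * g y) x
       - (m x * (f x * Δ g x) + m x * (g x * Δ f x))))).
    by rewrite sumV_scal sumV_minus sumV_plus sum_m_Lap (Lap_self_adjoint g f); field.
  by move=> x; rewrite /Gam; ring.
rewrite (sumV_ext _ _ (fun x => / 2 * (m x * Δ (Γ f f) x)
   - (m x * Γ f (Δ f) x + K * (m x * Γ f f x)))); last first.
  by move=> x; rewrite Gam2E; ring.
rewrite sumV_minus sumV_plus !sumV_scal sum_m_Lap !sumG.
rewrite (sumV_ext _ (fun x => m x * (f x * L f x)) (fun x =>
  m x * (f x * Δ (Δ f) x) + K * (m x * (f x * Δ f x)))); last first.
  by move=> x; rewrite /L; ring.
by rewrite sumV_plus sumV_scal; ring.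
Qed.

Lemma L_self_adjoint f g :
  sumV (fun x => m x * (f x * L g x)) = sumV (fun x => m x * (g x * L f x)).
Proof.
have E u v : sumV (fun x => m x * (u x * L v x)) =
    sumV (fun x => m x * (Δ u x * Δ v x)) + K * sumV (fun x => m x * (u x * Δ v x)).
  rewrite (sumV_ext _ _ (fun x =>
    m x * (u x * Δ (Δ v) x) + K * (m x * (u x * Δ v x)))); last first.
    by move=> x; rewrite /L; ring.
  rewrite sumV_plus sumV_scal Lap_self_adjoint; congr (_ + _).
  by apply: sumV_ext => x; ring.
rewrite !E (Lap_self_adjoint f g); congr (_ + _).
by apply: sumV_ext => x; ring.
Qed.

Lemma L_lin s f g x : L (fun y => f y + s * g y) x = L f x + s * L g x.
Proof.
have D1 y : Δ (fun y => f y + s * g y) y = 1 * Δ f y + s * Δ g y.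
  by rewrite -Lap_lin; apply: Lap_ext => z; ring.
by rewrite /L D1 (Lap_ext _ _ x D1) Lap_lin; ring.
Qed.

(* The form [f |-> sum_x m x (Γ2 f - K Γ f) x] is nonnegative, so a zero of it
   lies in its radical. *)
Lemma CD_equality_radical f :
  (forall x, Γ2 f f x = K * Γ f f x) -> forall x, L f x = 0.
Proof.
move=> ef; pose Q g := sumV (fun x => m x * (g x * L g x)).
have Q0 g : 0 <= Q g.
  rewrite /Q -sum_m_CD_defect; apply: sumV_ge0 => x.
  by apply: Rmult_le_pos; [exact: Rlt_le (m_gt0 x) | have := HCD g x; lra].
have Qf : Q f = 0.
  rewrite /Q -sum_m_CD_defect (sumV_ext _ _ (fun=> 0 * 0)) ?sumV_scal; first by ring.
  by move=> x; rewrite ef; ring.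
pose b := sumV (fun x => m x * (L f x * L f x)).
have Qexp s : Q (fun y => f y + s * L f y) = Q f + 2 * s * b + s * s * Q (L f).
  have -> : 2 * s * b = s * b + s * sumV (fun x => m x * (f x * L (L f) x)).
    by rewrite (L_self_adjoint f (L f)) -/b; ring.
  rewrite /Q /b -!sumV_scal -!sumV_plus; apply: sumV_ext => x.
  by rewrite L_lin; ring.
have term x : 0 <= m x * (L f x * L f x).
  exact: Rmult_le_pos (Rlt_le _ _ (m_gt0 x)) (Rle_0_sqr _).
have b0 : b = 0.
  have bpos : 0 <= b by apply: sumV_ge0.
  have c0 := Q0 (L f); set c := Q (L f) in c0.
  (* A nearly optimal [s] for [2 * s * b + s * s * c]; the added 1 keeps the denominator positive
     when [c = 0]. *)
  have := Q0 (fun y => f y + (- b / (c + 1)) * L f y).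
  rewrite Qexp Qf -/c => h.
  have E : (0 + 2 * (- b / (c + 1)) * b + - b / (c + 1) * (- b / (c + 1)) * c)
      * ((c + 1) * (c + 1)) = - (b * b) * (c + 2) by field; lra.
  have : 0 <= - (b * b) * (c + 2).
    by rewrite -E; apply: Rmult_le_pos => //; nra.
  by nra.
move=> x; have := le_sumV _ _ x term; rewrite -/b b0 => h.
have mx := m_gt0 x; have := term x => h'.
have : Rsqr (L f x) = 0 by rewrite /Rsqr; nra.
exact: Rsqr_0_uniq.
Qed.

(** [L f = 0] says that [Δ f + K * f] is harmonic, hence constant; shifting [f] by this constant
    over [K] absorbs it. *)
Lemma CD_equality_eigen f (x : V) : (forall x, Γ2 f f x = K * Γ f f x) ->
  exists C, eigen (fun y => f y - C).
Proof.
move=> ef; have Lf := CD_equality_radical f ef.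
exists ((Δ f x + K * f x) / K) => y.
rewrite (Lap_add_const _ f (- ((Δ f x + K * f x) / K))); last by move=> z; ring.
have : 1 * Δ f y + K * f y = 1 * Δ f x + K * f x.
  apply: (subharmonic_eq (fun z => 1 * Δ f z + K * f z)) => z.
  by rewrite Lap_lin; have := Lf z; rewrite /L; lra.
have -> : K * (f y - (Δ f x + K * f x) / K) = K * f y - (Δ f x + K * f x) by field; lra.
by lra.
Qed.

(** * Hypercube shell structure *)

Section Shell.
Variable x0 : V.
Let r x := INR (gdist w x0 x).

(** With no neighbour at equal distance, each difference [r y - r x] is -1 for nearer neighbours and
    1 for the others. *)
Lemma Lap_dist x :
  (forall y, adjb w x y -> gdist w x0 y <> gdist w x0 x) ->
  Δ r x = deg x - 2 * dminus w m x0 x.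
Proof.
move=> ne.
have -> : dminus w m x0 x = / m x * sumV (fun y =>
    if adjb w y x && ltn (gdist w y x0) (gdist w x x0) then w x y else 0).
  rewrite /dminus big_mkcond -sumV_scal; apply: eq_bigr => y _.
  by rewrite (w_sym y); case: ifP => _; rewrite /Rdiv; ring.
rewrite /Lap /Deg.
have -> : sumV (fun y => w x y * (r y - r x)) = sumV (fun y => w x y)
   - 2 * sumV (fun y =>
    if adjb w y x && ltn (gdist w y x0) (gdist w x x0) then w x y else 0).
  rewrite -sumV_scal -sumV_minus; apply: sumV_ext => y.
  rewrite adjb_sym !(gdist_sym _ x0).
  case: (adjbP x y) => [/adjbP xy|/w_eq0 ->]; last by rewrite /=; ring.
  have := gdist_adj x0 _ _ xy; have := ne _ xy.
  rewrite adjb_sym in xy; have := gdist_adj x0 _ _ xy; rewrite /r /=.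
  case: (ltngtP (gdist w x0 y) (gdist w x0 x)) => // h h1 _ h2.
    have -> : gdist w x0 x = (gdist w x0 y).+1 by apply/eqP; rewrite eqn_leq h1 h.
    by rewrite S_INR; ring.
  have -> : gdist w x0 y = (gdist w x0 x).+1 by apply/eqP; rewrite eqn_leq h2 h.
  by rewrite S_INR; ring.
by ring.
Qed.

Lemma root_neighbour : (1 < #|V|)%nat -> exists y, adjb w x0 y.
Proof.
move=> V1; apply/existsP; apply: contraT => /existsPn no.
have all0 : forall y, y = x0.
  apply: (connected_ind _ x0) => // y z -> yz.
  by have := no z; rewrite yz.
by case/card_gt1P: V1 => a [b [_ _ /eqP]]; rewrite (all0 a) (all0 b).
Qed.

Lemma Deg_root_gt0 : (1 < #|V|)%nat -> 0 < deg x0.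
Proof.
move=> /root_neighbour[y /adjbP wy].
have := le_sumV _ (fun z => w x0 z) y (w_ge0 x0).
by rewrite /Deg; have := Vm_gt0 x0; nra.
Qed.

Lemma eigen_dist_Gam C phi : deg x0 = D ->
  (forall x, r x = phi x + C) -> eigen phi -> forall x, Γ r r x = D / 2.
Proof.
move=> dx0 er ephi x.
rewrite (Gam_ext_const _ phi _ phi C C) // (eigen_Gam_const _ ephi x x0).
by rewrite -(Gam_ext_const r phi r phi C C) //; have := Gam_dist_root x0; rewrite -/r; lra.
Qed.

Lemma eigen_dist_HSS C phi : (1 < #|V|)%nat -> deg x0 = D ->
  (forall x, r x = phi x + C) -> eigen phi -> HSS w m (2 * D / K) (K / 2) x0.
Proof.
move=> V1 dx0 er ephi.
have Dpos : 0 < D by rewrite -dx0; apply: Deg_root_gt0.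
(* [deg x - D = / m x * S] with [S >= 0] and [deg x <= D], so [S] and all its terms vanish. *)
have sat x : deg x = D /\ forall y, adjb w x y -> Rsqr (r y - r x) = 1.
  pose S := sumV (fun y => w x y - w x y * ((r y - r x) * (r y - r x))).
  have eS : deg x - 2 * Γ r r x = / m x * S := two_Gam_dist x0 x.
  rewrite (eigen_dist_Gam C phi dx0 er ephi) in eS.
  have pos y : 0 <= w x y - w x y * ((r y - r x) * (r y - r x)).
    have h : w x y * ((r y - r x) * (r y - r x)) <= w x y := w_dist_le x0 x y.
    by lra.
  have S0 : 0 <= S by apply: sumV_ge0.
  have := Deg_le_max x; have vx := Vm_gt0 x => dx.
  have Sz : S = 0 by nra.
  split; first by rewrite Sz in eS; lra.
  move=> y /adjbP wxy; have := le_sumV _ _ y pos; rewrite -/S Sz.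
  have := pos y; rewrite /Rsqr; set q := _ * (r y - r x) => h1 h2.
  have : w x y * (1 - q) = 0 by lra.
  by case/Rmult_integral; lra.
(* Parity of the distance is the bipartition; it also rules out edges inside a sphere, as [Lap_dist]
   requires. *)
have edge x y : adjb w x y -> odd (gdist w x0 x) <> odd (gdist w x0 y).
  have half a b : adjb w a b -> r b = r a + 1 -> gdist w x0 b = (gdist w x0 a).+1.
    by move=> _ e; apply: INR_eq; rewrite S_INR.
  move=> xy; have := proj2 (sat x) y xy; rewrite -Rsqr_1 => /Rsqr_eq [] e.
    by rewrite (half x y xy) /=; [case: odd | lra].
  rewrite adjb_sym in xy.
  by rewrite (half y x xy) /=; [case: odd | lra].
have L0 x := Lap_dist x (fun y xy e => edge x y xy (congr1 odd (esym e))).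
have Lphi x : Δ r x = - K * phi x.
  by rewrite (Lap_add_const _ phi C) //; have := ephi x; lra.
have dm0 : dminus w m x0 x0 = 0.
  rewrite /dminus big1 // => y /andP[_]; rewrite gdist0.
  by case: (gdist w y x0).
(* Evaluation at the root, where [r] and [dminus] vanish, determines the constant. *)
have CK : K * C = D.
  have := L0 x0; rewrite dm0 Lphi dx0; have := er x0.
  by rewrite /r gdist0 /=; nra.
split; [|split; [|split; [|split]]].
- by apply: Rdiv_lt_0_compat; lra.
- lra.
- by move=> x; rewrite (proj1 (sat x)); field; lra.
- by exists (fun x => odd (gdist w x0 x)) => x y /adjbP; apply: edge.
move=> x; rewrite gdist_sym -/(r x).
have := L0 x; rewrite Lphi (proj1 (sat x)); have := er x; nra.
Qed.

(** Colours alternate along walks, so the parity of the distance determines the colour. *)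
Lemma bipartite_dist_neq : bipartite w ->
  forall x y, adjb w x y -> gdist w x0 x <> gdist w x0 y.
Proof.
case=> c hc.
have ck k y : walkb w k x0 y -> c y = odd k (+) c x0.
  elim: k y => [|k IH] y; first by move/eqP <-.
  case/existsP=> z /andP[/IH cz /adjbP/hc]; rewrite cz /=.
  by case: (c y) (odd k) (c x0) => [] [] [].
move=> x y /adjbP/hc nc e; apply: nc.
by rewrite (ck _ _ (gdist_walk x0 x)) (ck _ _ (gdist_walk x0 y)) e.
Qed.

(** At a farthest vertex every neighbour is strictly nearer, so [dminus] is the full degree [D], and
    the shell condition gives the distance. *)
Lemma HSS_diam : HSS w m (2 * D / K) (K / 2) x0 ->
  exists y, r y = 2 * D / K.
Proof.
case=> _ [_ [hdeg [/bipartite_dist_neq ne hdm]]].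
have [z hz] := exists_argmax r x0; exists z.
have dz : deg z = D by rewrite hdeg; field; lra.
have : dminus w m x0 z = deg z.
  have e := Lap_dist z (fun y zy e => ne _ _ zy (esym e)).
  have : Δ r z = - deg z; last by lra.
  rewrite /Lap /Deg Ropp_mult_distr_r; congr (_ * _).
  rewrite [- _](_ : _ = -1 * sumV (fun y => w z y)); last by ring.
  rewrite -sumV_scal; apply: sumV_ext => y.
  case: (adjbP z y) => [/adjbP zy|/w_eq0 ->]; last by ring.
  suff : r z = r y + 1 by move=> ->; ring.
  have lt : (gdist w x0 y < gdist w x0 z)%nat.
    rewrite ltn_neqAle; apply/andP; split; first by apply/eqP => h; apply: (ne _ _ zy).
    by apply/leP; apply: INR_le; apply: hz.
  rewrite adjb_sym in zy; have := dist_adj x0 _ _ zy.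
  by move/leP/le_INR: lt; rewrite S_INR /r; lra.
rewrite hdm gdist_sym -/(r z) dz => e.
by apply: (Rmult_eq_reg_l (K / 2)); [rewrite e; field; lra | lra].
Qed.

End Shell.
(** * Heat semigroup *)

Lemma Pt_eq t f x l :
  is_series (fun k => t ^ k / INR (Factorial.fact k) * iterLap w m k f x) l ->
  Pt w m t f x = l.
Proof.
move/is_series_Reals => hl; rewrite /Pt.
by apply: (uniqueness_sum _ _ _ _ hl); apply: epsilon_spec; exists l.
Qed.

Lemma Pt_eigen t C phi f x : (forall y, f y = phi y + C) -> eigen phi ->
  Pt w m t f x = exp (- K * t) * phi x + C.
Proof.
move=> ef ephi; apply: Pt_eq.
have iterE k y : iterLap w m k.+1 f y = (- K) ^ k.+1 * phi y.
  elim: k y => [|k IH] y.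
    by rewrite /= (Lap_add_const _ phi C) //; have := ephi y; lra.
  change (Δ (iterLap w m k.+1 f) y = (- K) ^ k.+2 * phi y).
  rewrite (Lap_ext _ (fun z => (- K) ^ k.+1 * phi z + 0 * phi z)).
    by rewrite Lap_lin (_ : Δ phi y = - K * phi y) /=; [ring | have := ephi y; lra].
  by move=> z; rewrite IH; ring.
have hexp : is_series (fun k => phi x * (/ INR (Factorial.fact k) * (- K * t) ^ k))
    (phi x * exp (- K * t)).
  by apply: is_series_scal_l; apply/is_pseries_R; apply: is_exp_Reals.
have hC : is_series (fun k => if k is 0%nat then C else 0) C.
  apply/is_series_Reals => e e0; exists 0%nat => n _.
  have -> : sum_f_R0 (fun k => if k is 0%nat then C else 0) n = C.
    by elim: n => [|n IH] //=; rewrite IH; ring.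
  by rewrite /Rdist Rminus_diag Rabs_R0.
rewrite Rmult_comm; move: (is_series_plus _ _ _ _ hexp hC).
apply: is_series_ext => -[|k]; first by rewrite /= ef /plus /=; field.
rewrite iterE Rpow_mult_distr; move: (INR_fact_neq_0 k.+1).
by set F := INR _ => F0; rewrite /plus /=; field.
Qed.

(** The Laplacian expands the sup norm by at most [2 * D]; the added 1 makes the base invertible
    even for [D = 0]. *)
Lemma iterLap_bound f A : (forall x, Rabs (f x) <= A) ->
  forall k x, Rabs (iterLap w m k f x) <= A * (2 * D + 1) ^ k.
Proof.
move=> fA; elim=> [|k IH] x; first by rewrite Rmult_1_r.
set u := iterLap w m k f in IH; set B := A * (2 * D + 1) ^ k in IH.
have hu y := proj1 (Rabs_le_between _ _) (IH y).
have B0 : 0 <= B by apply: Rle_trans (Rabs_pos _) (IH x).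
have -> : A * (2 * D + 1) ^ k.+1 = (2 * D + 1) * B by rewrite /B /=; ring.
have key s : s * s = 1 -> s * Δ u x <= 2 * B * deg x.
  move=> s1; rewrite /Lap /Deg.
  have : 0 <= sumV (fun y => 2 * B * w x y - s * (w x y * (u y - u x))).
    apply: sumV_ge0 => y; have := hu y; have := hu x; have := w_ge0 x y.
    have [->|->] : s = 1 \/ s = -1.
    - by have : (s - 1) * (s + 1) = 0 by [lra]; case/Rmult_integral; lra.
    - by nra.
    by nra.
  rewrite sumV_minus (sumV_scal _ _ (fun y => w x y)) sumV_scal => h.
  by have := Rmult_le_pos _ _ (Rlt_le _ _ (Vm_gt0 x)) h; lra.
have := key 1; have := key (-1); have := Deg_le_max x; have := Deg_ge0 x.
move=> d0 dD k1 k2; apply: Rabs_le; change (iterLap w m k.+1 f x) with (Δ u x).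
have := k1 ltac:(lra); have := k2 ltac:(lra).
by have := Rmult_le_compat_l _ _ _ B0 dD; lra.
Qed.

(** Near 0 the semigroup is a power series in [t] of positive radius, so its first two coefficients
    give value and derivative. *)
Lemma Pt_is_derive0 f x :
  Pt w m 0 f x = f x /\ is_derive (fun t => Pt w m t f x) 0 (Δ f x).
Proof.
pose a k := iterLap w m k f x / INR (Factorial.fact k).
have D0 := Degmax_ge0 x.
have [z hz] := exists_argmax (fun y => Rabs (f y)) x.
have bound := iterLap_bound f _ hz; set A := Rabs (f z) in bound.
have c0 : 0 < / (2 * D + 1) by apply: Rinv_0_lt_compat; lra.
have rad : Rbar_lt 0 (CV_radius a).
  apply: Rbar_lt_le_trans (c0 : Rbar_lt 0 (/ (2 * D + 1))) _.
  case: (CV_radius_bounded a) => ub _; apply: ub; exists A => k.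
  rewrite /a Rabs_mult Rabs_div; last exact: INR_fact_neq_0.
  have f1 : 1 <= INR (Factorial.fact k).
    by apply: (le_INR 1); apply: Factorial.lt_O_fact.
  rewrite (Rabs_right (INR _)); last lra.
  rewrite pow_inv Rabs_inv (Rabs_right (_ ^ _)); last by apply/Rle_ge/pow_le; lra.
  have p0 : 0 < (2 * D + 1) ^ k by apply: pow_lt; lra.
  apply: (Rle_trans _ (A * (2 * D + 1) ^ k / 1 * / (2 * D + 1) ^ k)); last first.
    by right; field; lra.
  apply: Rmult_le_compat_r; first exact/Rlt_le/Rinv_0_lt_compat.
  apply: Rmult_le_compat (bound k x) _; first exact: Rabs_pos.
    by apply/Rlt_le/Rinv_0_lt_compat; lra.
  by apply: Rinv_le_contravar; lra.
have PtE t : Rbar_lt (Rabs t) (CV_radius a) -> Pt w m t f x = PSeries a t.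
  move=> ht; apply: Pt_eq.
  have := PSeries_correct _ _ (CV_radius_inside _ _ ht) => /is_pseries_R.
  apply: is_series_ext => k.
  change (a k * t ^ k = t ^ k / INR (Factorial.fact k) * iterLap w m k f x).
  by rewrite /a /Rdiv; ring.
have rad0 : Rbar_lt (Rabs 0) (CV_radius a) by rewrite Rabs_R0.
split; first by rewrite (PtE _ rad0) PSeries_0 /a /= Rdiv_1_r.
have -> : Δ f x = PSeries (PS_derive a) 0.
  by rewrite PSeries_0 /PS_derive /a /=; field.
apply: (is_derive_ext_loc (PSeries a)); last exact: is_derive_PSeries.
(* A finite radius of agreement, needed since [CV_radius a] may be infinite. *)
have [e he] : exists e : posreal, Rbar_lt e (CV_radius a).
  case: (CV_radius a) rad => [c||] //= h; last by exists (mkposreal 1 Rlt_0_1).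
  by exists (mkposreal (c / 2) ltac:(lra)) => /=; lra.
exists e => t; rewrite /ball /= /AbsRing_ball /abs /= /minus /plus /opp /= => ht.
symmetry; apply: PtE; apply: Rbar_lt_trans he => /=.
by rewrite -(Rplus_0_r t) -Ropp_0.
Qed.

Lemma is_derive_sumV (F : V -> R -> R) (dF : V -> R) t :
  (forall y, is_derive (F y) t (dF y)) ->
  is_derive (fun s => sumV (fun y => F y s)) t (sumV dF).
Proof.
move=> hF; rewrite /sumV; elim: (index_enum V) => [|y s IH].
  rewrite big_nil; apply: (is_derive_ext (fun=> 0)); last exact: is_derive_const.
  by move=> u; rewrite big_nil.
rewrite big_cons.
apply: (is_derive_ext (fun u => F y u + \big[Rplus/0]_(z <- s) F z u)).
  by move=> u; rewrite big_cons.
exact: is_derive_plus.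
Qed.

Lemma Gam_is_derive (p : R -> V -> R) (dp : V -> R) t x :
  (forall y, is_derive (fun s => p s y) t (dp y)) ->
  is_derive (fun s => Γ (p s) (p s) x) t (2 * Γ (p t) dp x).
Proof.
move=> hp.
apply: (is_derive_ext (fun s => / 2 * / m x *
   sumV (fun y => w x y * ((p s y - p s x) * (p s y - p s x))))).
  by move=> s; rewrite GamE Rmult_assoc.
have -> : 2 * Γ (p t) dp x = / 2 * / m x *
    sumV (fun y => 2 * (w x y * ((p t y - p t x) * (dp y - dp x)))).
  by rewrite GamE sumV_scal; ring.
apply: is_derive_scal; apply: is_derive_sumV => y.
have sqr u v a b : is_derive u t a -> is_derive v t b -> is_derive
    (fun s => w x y * ((u s - v s) * (u s - v s))) t (2 * (w x y * ((u t - v t) * (a - b)))).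
  move=> hu hv; auto_derive; first by repeat split; eexists; eassumption.
  by rewrite (is_derive_unique _ _ _ hu) (is_derive_unique _ _ _ hv); ring.
exact: (sqr (fun s => p s y) (fun s => p s x) _ _ (hp y) (hp x)).
Qed.

(** Difference quotients with positive increments already determine the two-sided derivative. *)
Lemma is_derive_right_zero (q : R -> R) l :
  (forall t, 0 <= t -> q t = 0) -> is_derive q 0 l -> l = 0.
Proof.
move=> q0 /is_derive_Reals hq.
apply: cond_eq => e e0; have [d hd] := hq e e0.
have dpos := cond_pos d.
have := hd (d / 2) ltac:(lra); rewrite Rabs_right; last lra.
rewrite Rplus_0_l !q0; [|lra|lra].
move=> /(_ ltac:(lra)).
have -> : (0 - 0) / (d / 2) - l = - (l - 0) by field; lra.
by rewrite Rabs_Ropp.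
Qed.

(** Differentiating the identity at [t = 0] gives [2 * Γ f (Δ f) = - 2 * K * Γ f f + Δ (Γ f f)]. *)
Lemma Pt_Gam_equality_Gam2 f :
  (forall t, 0 <= t -> forall x,
     Γ (Pt w m t f) (Pt w m t f) x = exp (- 2 * K * t) * Pt w m t (Γ f f) x) ->
  forall x, Γ2 f f x = K * Γ f f x.
Proof.
move=> eqt x.
pose q t := Γ (Pt w m t f) (Pt w m t f) x - exp (- 2 * K * t) * Pt w m t (Γ f f) x.
have [P0 dP] := Pt_is_derive0 (Γ f f) x.
have dq : is_derive q 0
    (2 * Γ (Pt w m 0 f) (Δ f) x - (- 2 * K * Γ f f x + Δ (Γ f f) x)).
  apply: is_derive_minus.
    by apply: Gam_is_derive => y; apply: (proj2 (Pt_is_derive0 f y)).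
  have expM u a : is_derive u 0 a ->
      is_derive (fun s => exp (- 2 * K * s) * u s) 0 (- 2 * K * u 0 + a).
    move=> du; auto_derive; first by exists a.
    by rewrite (is_derive_unique _ _ _ du) !Rmult_0_r exp_0; ring.
  by rewrite -P0; apply: (expM (fun s => Pt w m s (Γ f f) x)).
have q0 t : 0 <= t -> q t = 0 by move=> t0; rewrite /q eqt //; ring.
have := is_derive_right_zero q _ q0 dq.
rewrite (Gam_ext_const _ f _ (Δ f) 0 0).
- by rewrite Gam2E; lra.
- by move=> y; rewrite (proj1 (Pt_is_derive0 f y)); ring.
by move=> y; ring.
Qed.

Lemma eigen_Pt_Gam C phi f : (forall x, f x = phi x + C) -> eigen phi ->
  forall t x, Γ (Pt w m t f) (Pt w m t f) x = exp (- 2 * K * t) * Pt w m t (Γ f f) x.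
Proof.
move=> ef ephi t x.
have E y : Γ f f y = Γ phi phi x.
  by rewrite (Gam_ext_const _ phi _ phi C C) // (eigen_Gam_const _ ephi y x).
have -> : Pt w m t (Γ f f) x = Γ phi phi x.
  (* [Γ f f] is constant: the zero eigenfunction plus a constant, hence fixed by the semigroup. *)
  rewrite (Pt_eigen t (Γ phi phi x) (fun=> 0)); first by ring.
    by move=> y; rewrite E; ring.
  move=> y; rewrite /Lap (sumV_ext _ _ (fun=> 0 * 0)) ?sumV_scal; first by ring.
  by move=> z; ring.
pose e := exp (- K * t).
rewrite (Gam_ext_const _ (fun y => e * phi y + 0 * phi y)
                       _ (fun y => e * phi y + 0 * phi y) C C).
- rewrite Gam_linl (Gam_sym phi) Gam_linl.
  by rewrite (_ : exp (- 2 * K * t) = e * e); [ring | rewrite -exp_plus; congr exp; ring].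
- by move=> y; rewrite (Pt_eigen t C phi) // /e; ring.
by move=> y; rewrite (Pt_eigen t C phi) // /e; ring.
Qed.

End Calculus.

(** * Assembly of the equivalences *)

Theorem theorem4 (V : finType) (w : V -> V -> R) (m : V -> R) (K : R)
  (x0 : V)
  (Hwg : weighted_graph w m) (Hconn : connected w) (Hnontriv : ltn 1%nat #|V|)
  (HK : 0 < K) (HCD : CD w m K) :
  let D := Degmax w m in
  let f0 := fun x => INR (gdist w x0 x) in
  let c1 := exists y0 : V, INR (gdist w x0 y0) = 2 * D / K in
  let c2 := Deg w m x0 = D /\
            forall t : R, 0 <= t -> forall x : V,
              Gam w m (Pt w m t f0) (Pt w m t f0) x
              = exp (- 2 * K * t) * Pt w m t (Gam w m f0 f0) x in
  let c3 := Deg w m x0 = D /\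
            forall x : V, Gam2 w m f0 f0 x = K * Gam w m f0 f0 x in
  let c4 := Deg w m x0 = D /\
            exists (C : R) (phi : V -> R),
              (forall x, f0 x = phi x + C) /\
              (forall x, - Lap w m phi x = K * phi x) in
  let c5 := HSS w m (2 * D / K) (K / 2) x0 in
  (c1 <-> c2) /\ (c1 <-> c3) /\ (c1 <-> c4) /\ (c1 <-> c5).
Proof.
move=> D f0 c1 c2 c3 c4 c5.
(* Two cycles meet at [c4]: [c1 -> c4 -> c5 -> c1] and [c4 -> c2 -> c3 -> c4]. *)
have c14 : c1 -> c4.
  case=> y0 hy; have f00 : f0 x0 = 0 by apply: dist_root.
  have [dx [C hC]] : Deg w m x0 = D /\
      exists C, forall z, - Lap w m (fun t => f0 t - C) z = K * (f0 z - C).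
    apply: (diam_eigen _ _ _ Hwg Hconn _ HK HCD _ x0 y0).
      exact: Gam_dist_le.
    by rewrite f00 Rminus_0_r.
  by split=> //; exists C, (fun t => f0 t - C); split=> // x; ring.
have c45 : c4 -> c5.
  by case=> dx [C [phi [e1 e2]]]; apply: (eigen_dist_HSS _ _ _ Hwg Hconn K HK HCD x0 C phi).
have c51 : c5 -> c1 by apply: HSS_diam.
have c42 : c4 -> c2.
  case=> dx [C [phi [e1 e2]]]; split=> // t _ x.
  exact: (eigen_Pt_Gam _ _ _ Hwg Hconn K HCD C phi).
have c23 : c2 -> c3.
  case=> dx e; split=> //; exact: Pt_Gam_equality_Gam2.
have c34 : c3 -> c4.
  case=> dx e; split=> //.
  have [C hC] := CD_equality_eigen _ _ _ Hwg Hconn K HK HCD f0 x0 e.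
  by exists C, (fun y => f0 y - C); split=> // x; ring.
by tauto.
Qed.
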